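(* Let $N\ge 1$, $\eta>0$, and let $J:\mathbb{R}^N\to[0,\infty)$ be measurable, radially symmetric, with $\int_{\mathbb{R}^N}J(y)\,dy=1$, $\int_{\mathbb{R}^N}(e^{p\cdot y}-1)J(y)\,dy<+\infty$ for every $p\in\mathbb{R}^N$, and $\operatorname{supp}(J)=\overline{B}_\eta$. Let $u_0:\mathbb{R}^N\to[0,\infty)$ be continuous and bounded, let $u$ be the bounded strong solution of the non-local equation in $\mathbb{R}^N$ with initial datum $u_0$, and for $R>0$ let $u_R$ be the solution of the non-local Dirichlet problem in $B_R$ with initial datum $u_0$ (both defined in the context). Then for every $\theta\in(0,1)$ and every fixed $t>0$, $$\sup_{|x|\le\theta R}|u-u_R|(x,t)\le\exp\Big(-\frac{(1-\theta)R}{\eta}\ln\Big(\frac{(1-\theta)R}{t}\Big)+o(1)R\Big)\qquad\text{as }R\to\infty,$$ where $o(1)$ denotes a quantity tending to $0$ as $R\to\infty$.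
   Context: $B_R=\{x\in\mathbb{R}^N:|x|\le R\}$, and $\overline{B}_\eta$ is the closed ball of radius $\eta$ centred at $0$. A strong solution of the equation in $\mathbb{R}^N$ with initial datum $u_0$ is a function $u$, continuous on $\mathbb{R}^N\times[0,\infty)$, with $u_t$ continuous on $\mathbb{R}^N\times(0,\infty)$, satisfying pointwise $\partial_t u(x,t)=\int_{\mathbb{R}^N}J(x-y)u(y,t)\,dy-u(x,t)$ in $\mathbb{R}^N\times(0,\infty)$ and $u(x,0)=u_0(x)$. Here $u$ is the unique bounded strong solution. The solution $u_R$ of the non-local Dirichlet problem is the bounded function, continuous on $B_R\times[0,\infty)$, with $\partial_t u_R(x,t)=\int_{B_R}J(x-y)u_R(y,t)\,dy-u_R(x,t)$ in $B_R\times(0,\infty)$, $u_R(x,0)=u_0(x)$ in $B_R$, and $u_R=0$ on $(\mathbb{R}^N\setminus B_R)\times[0,\infty)$. *)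

(* Defs.v *)
From HB Require Import structures.
From mathcomp Require Import all_boot all_order all_algebra.
From mathcomp Require Import all_classical all_reals all_analysis.
From mathcomp Require Import measurable_realfun.

Set Implicit Arguments.
Unset Strict Implicit.
Unset Printing Implicit Defensive.

Import Order.TTheory GRing.Theory Num.Theory.
Import numFieldNormedType.Exports.

Local Open Scope classical_set_scope.
Local Open Scope ring_scope.

(* R^N with N = n.+1 >= 1 is 'rV[R]_n.+1. Its library topology comes from the
   sup norm, which induces the usual topology; `|x| would denote that sup norm,
   hence the separate Euclidean norm below. *)

Section euclidean.
Variables (R : realType) (n : nat).
Implicit Types x y : 'rV[R]_n.+1.

Definition dot x y : R := \sum_i x 0 i * y 0 i.

Definition enorm x : R := Num.sqrt (dot x x).

Definition eball (r : R) : set 'rV[R]_n.+1 := [set x | enorm x <= r].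

End euclidean.

(* The library has Lebesgue measure on R only. On R^N we use the textbook
   construction: the outer measure given by countable covers by closed boxes,
   restricted to its Caratheodory-measurable (= Lebesgue-measurable) sets. *)
Section lebesgue_outer.
Variables (R : realType) (n : nat).
Local Notation V := 'rV[R]_n.+1.

Definition box (ab : V * V) : set V :=
  [set x | forall i, ab.1 0 i <= x 0 i <= ab.2 0 i].

Definition box_vol (ab : V * V) : R :=
  \prod_i Num.max 0 (ab.2 0 i - ab.1 0 i).

Definition box_cover (A : set V) : set (nat -> V * V) :=
  [set F | A `<=` \bigcup_k box (F k)].

Definition leb_outer (A : set V) : \bar R :=
  ereal_inf [set (\sum_(k <oo) (box_vol (F k))%:E)%E | F in box_cover A].

Lemma box_vol_ge0 ab : 0 <= box_vol ab.
Proof. by apply: prodr_ge0 => i _; rewrite le_max lexx. Qed.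

Lemma box_vol00 : box_vol (0, 0) = 0.
Proof. by rewrite /box_vol big_ord_recl /= subrr maxxx mul0r. Qed.

Local Open Scope ereal_scope.

Lemma leb_outer_ge0 A : 0 <= leb_outer A.
Proof.
apply: le_ereal_inf_tmp => _ [F _ <-].
by apply: nneseries_ge0 => k _ _; rewrite lee_fin box_vol_ge0.
Qed.

Lemma leb_outer0 : leb_outer set0 = 0.
Proof.
apply/eqP; rewrite eq_le leb_outer_ge0 andbT.
apply: ereal_inf_lbound; exists (fun=> (0, 0)%R) => //.
by apply: eseries0 => k _ _; rewrite box_vol00.
Qed.

Lemma le_leb_outer : {homo leb_outer : A B / A `<=` B >-> A <= B}.
Proof.
move=> A B AB; apply: ereal_inf_le_tmp => _ [F BF <-].
by exists F => //; exact: subset_trans BF.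
Qed.

Lemma leb_outer_sigma_subadditive : sigma_subadditive leb_outer.
Proof.
move=> A; have [[i ioo]|] := pselect (exists i, leb_outer (A i) = +oo).
  rewrite (eseries_pinfty _ _ ioo) ?leey// => k _.
  by rewrite -ltNye (lt_le_trans _ (leb_outer_ge0 _)).
rewrite -forallNE => Aoo.
apply/lee_addgt0Pr => _/posnumP[e].
rewrite (le_trans _ (epsilon_trick _ _ _))//; last first.
  by move=> k; exact: leb_outer_ge0.
pose P k (F : nat -> V * V) := box_cover (A k) F /\
  \sum_(j <oo) (box_vol (F j))%:E
    <= leb_outer (A k) + (e%:num / (2 ^ k.+1)%:R)%:E.
have [G PG] : {G : nat -> nat -> V * V & forall k, P k (G k)}.
  apply: (@choice _ _ P) => k; rewrite /P /leb_outer.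
  set S := (X in ereal_inf X); move infS : (ereal_inf S) => iS.
  case: iS infS => [r Sr|Soo|Soo].
  - have en1 : (0 < e%:num / (2 ^ k.+1)%:R)%R by [].
    have /(lb_ereal_inf_adherent en1) : ereal_inf S \is a fin_num by rewrite Sr.
    move=> [x [F AF Fx] xS].
    by exists F; split => //; rewrite Fx -Sr; exact/ltW.
  - by have := Aoo k; rewrite /leb_outer Soo.
  - by have := leb_outer_ge0 (A k); rewrite /leb_outer Soo.
pose vol ij : \bar R := (box_vol (uncurry G ij))%:E.
have vol_ge0 ij : 0 <= vol ij by rewrite lee_fin box_vol_ge0.
apply: (@le_trans _ _ (\esum_(ij in setT) vol ij)).
  apply: ereal_inf_lbound => /=.
  have /card_esym/ppcard_eqP[f] := card_nat2.
  exists (uncurry G \o f).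
    move=> t [i _ Ait]; have [j _ Gijt] := (PG i).1 _ Ait.
    by exists (f^-1%FUN (i, j)) => //=; rewrite invK ?inE.
  rewrite -(esum_pred_image vol _ xpredT) ?[fun=> _]set_true//.
  by rewrite image_eq.
rewrite (_ : esum _ _ = \sum_(i <oo) \sum_(j <oo) vol (i, j)); last first.
  pose L : nat -> set (nat * nat) := fun i => [set (i, j) | j in setT].
  rewrite (_ : setT = \bigcup_k L k); last first.
    by rewrite predeqE => -[a b]; split => // _; exists a => //; exists b.
  rewrite esum_bigcupT //=; last first.
    apply/trivIsetP => i j _ _ ij.
    rewrite predeqE => -[k m] /=; split => //= -[] [_] _ [<-{k} _].
    by move=> [m' _] [] /esym/eqP; rewrite (negbTE ij).
  rewrite -(image_id [set: nat]) -fun_true esum_pred_image//; last first.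
    by move=> k _; exact: esum_ge0.
  apply: eq_eseriesr => /= j _.
  rewrite -(esum_pred_image vol (pair j) predT)//=; last first.
    by move=> ? ? _ _; exact: (@can_inj _ _ _ snd).
  by congr esum; rewrite predeqE => -[a b]; split; move=> [i _ <-]; exists i.
apply: lee_nneseries => [i _ _|i _]; first by apply: nneseries_ge0.
exact: (PG i).2.
Qed.

End lebesgue_outer.

HB.instance Definition _ (R : realType) (n : nat) :=
  isOuterMeasure.Build R 'rV[R]_n.+1 (@leb_outer R n)
    (@leb_outer0 R n) (@leb_outer_ge0 R n) (@le_leb_outer R n)
    (@leb_outer_sigma_subadditive R n).

(* 'rV[R]_n.+1 with the Lebesgue sigma-algebra. *)
Definition lebRn (R : realType) (n : nat) : measurableType _ :=
  caratheodory_type (@leb_outer R n).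

Definition lebesgueN (R : realType) (n : nat) : set (lebRn R n) -> \bar R :=
  @leb_outer R n.

HB.instance Definition _ (R : realType) (n : nat) :=
  isMeasure.Build _ _ _ (@lebesgueN R n)
    (@caratheodory_measure0 _ _ (@leb_outer R n))
    (@caratheodory_measure_ge0 _ _ (@leb_outer R n))
    (@caratheodory_measure_sigma_additive _ _ (@leb_outer R n)).

Arguments lebesgueN {R n}.

Section problems.
Variables (R : realType) (n : nat).
Local Notation V := 'rV[R]_n.+1.
Implicit Types (J g : V -> R) (u v : V -> R -> R).

(* Solutions are total functions of (x, t) : V * R; only times t >= 0 are
   constrained. *)
Definition bounded_solution u : Prop :=
  exists M : R, forall x t, 0 <= t -> `|u x t| <= M.

Definition strong_solution J g u : Prop :=
  [/\ {within [set z : V * R | 0 <= z.2], continuous (fun z => u z.1 z.2)},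
      {within [set z : V * R | 0 < z.2],
        continuous (fun z => derive1 (u z.1) z.2)},
      forall x (t : R), 0 < t ->
        is_derive t 1 (u x)
          (\int[lebesgueN]_y (J (x - y) * u y t) - u x t)
    & forall x, u x 0 = g x].

Definition dirichlet_solution J g (r : R) v : Prop :=
  [/\ bounded_solution v,
      {within [set z : V * R | eball r z.1 /\ 0 <= z.2],
        continuous (fun z => v z.1 z.2)},
      forall x (t : R), eball r x -> 0 < t ->
        is_derive t 1 (v x)
          (\int[lebesgueN]_(y in eball r) (J (x - y) * v y t) - v x t),
      forall x, eball r x -> v x 0 = g x
    & forall x (t : R), ~ eball r x -> 0 <= t -> v x t = 0].

End problems.

(* Main.v *)
Require Import Defs.
From HB Require Import structures.
From mathcomp Require Import all_boot all_order all_algebra.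
From mathcomp Require Import all_classical all_reals all_analysis.
From mathcomp Require Import measurable_realfun.
From mathcomp Require Import ring lra.

Set Implicit Arguments.
Unset Strict Implicit.
Unset Printing Implicit Defensive.

Import Order.TTheory GRing.Theory Num.Theory.
Import numFieldNormedType.Exports.

Local Open Scope classical_set_scope.
Local Open Scope ring_scope.

(** The error [w = u - uR r] vanishes at time [0] in the ball of radius [r],
    where it solves [w_t = J * w - w], and equals [u], hence is bounded by [M],
    outside. Fix [p >= 0] and let [K] be the exponential moment
    [\int J z * expR (p * enorm z)]. The triangle inequality gives
    [\int J (x - y) * expR (p * enorm y) <= K * expR (p * enorm x)], so that
    [M * expR (p * (enorm x - r)) * expR (K * t)] is a supersolution that
    dominates [w] outside the ball, and therefore everywhere
    ([truncation_error]). On [enorm x <= theta * r], with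
    [a = (1 - theta) * r], this reads
    [`|w| <= M * expR (- p * a + K * t)].

    The trivial bound [K <= expR (p * eta)], optimised over [p], yields the
    exponent [- a / eta * ln (a / t)] only up to an error of order [r].
    Since [J] is a density carried by the ball of radius [eta], and the sphere of
    radius [eta] is Lebesgue-null, dominated convergence improves it to
    [K <= e * expR (p * eta)] for any [e > 0] and all large [p]
    ([exp_moment_small]). Taking [expR (p * eta) = expR 1 * (a / t)], the terms
    linear in [r] become [- a / eta + e * expR 1 * a], which is negative for small
    [e] and absorbs [ln M]: the estimate holds with [o = 0].

    The analytic facts about Lebesgue measure on row vectors used here follow from
    its construction by box covers: an affine image [b + c * A] of a set has outer
    measure at most [`|c| ^+ n.+1] times that of [A]. This gives invariance under
    [y |-> x - y], and, by comparing concentric balls, that spheres are null.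
    Half-spaces split boxes exactly, so open sets and continuous functions are
    measurable. *)

(** * Euclidean norm *)

Section euclidean_norm.
Variables (R : realType) (n : nat).
Local Notation V := 'rV[R]_n.+1.
Implicit Types x y : V.

Lemma dotDl x y z : dot (x + y) z = dot x z + dot y z.
Proof.
by rewrite /dot -big_split; apply: eq_bigr => i _; rewrite mxE mulrDl.
Qed.

Lemma dotC x y : dot x y = dot y x.
Proof. by apply: eq_bigr => i _; rewrite mulrC. Qed.

Lemma dotZl c x y : dot (c *: x) y = c * dot x y.
Proof. by rewrite /dot mulr_sumr; apply: eq_bigr => i _; rewrite mxE mulrA. Qed.

Lemma dot_ge0 x : 0 <= dot x x.
Proof. by apply: sumr_ge0 => i _; rewrite -expr2 sqr_ge0. Qed.

Lemma enorm_ge0 x : 0 <= enorm x.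
Proof. exact: sqrtr_ge0. Qed.

Lemma sqr_enorm x : enorm x ^+ 2 = dot x x.
Proof. by rewrite sqr_sqrtr// dot_ge0. Qed.

Lemma enormZ c x : enorm (c *: x) = `|c| * enorm x.
Proof.
by rewrite /enorm dotZl dotC dotZl mulrA sqrtrM -?expr2 ?sqr_ge0// sqrtr_sqr.
Qed.

Lemma ler_coord_enorm x i : `|x 0 i| <= enorm x.
Proof.
rewrite -sqrtr_sqr ler_wsqrtr// /dot (bigD1 i)//= -expr2 lerDl.
by apply: sumr_ge0 => j _; rewrite -expr2 sqr_ge0.
Qed.

Lemma dot_le_enorm x y : dot x y <= enorm x * enorm y.
Proof.
have := enorm_ge0 x; rewrite le_eqVlt => /predU1P[x0|x_gt0].
  rewrite -x0 mul0r /dot big1// => i _.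
  have := ler_coord_enorm x i; rewrite -x0 normr_le0 => /eqP ->.
  by rewrite mul0r.
have := enorm_ge0 y; rewrite le_eqVlt => /predU1P[y0|y_gt0].
  rewrite -y0 mulr0 /dot big1// => i _.
  have := ler_coord_enorm y i; rewrite -y0 normr_le0 => /eqP ->.
  by rewrite mulr0.
have := dot_ge0 (enorm y *: x + (- enorm x) *: y).
rewrite dotDl !(dotC _ (_ + _)) !dotDl !(dotZl, dotC _ (_ *: _)) -!sqr_enorm.
rewrite (dotC y x) => h.
have {h} : 0 <= (2 * (enorm x * enorm y)) * (enorm x * enorm y - dot x y).
  by apply: le_trans h _; rewrite le_eqVlt; apply/orP; left; apply/eqP; ring.
by rewrite pmulr_rge0 ?subr_ge0// !mulr_gt0.
Qed.

Lemma ler_enormD x y : enorm (x + y) <= enorm x + enorm y.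
Proof.
rewrite -(@ler_pXn2r _ 2)// ?nnegrE ?addr_ge0 ?enorm_ge0//.
rewrite sqr_enorm dotDl !(dotC _ (_ + _)) !dotDl -!sqr_enorm (dotC y x).
have := dot_le_enorm x y; lra.
Qed.

Lemma enorm_continuous : continuous (@enorm R n).
Proof.
move=> x; apply: (@continuous_comp _ _ _ (fun x => dot x x) Num.sqrt); last first.
  exact: sqrt_continuous.
apply: (@continuous_big R _ +%R 0 xpredT _ V _ (fun i x => x 0 i * x 0 i)).
  exact: add_continuous.
move=> i _ {}x; apply: (@continuousM R V (fun x => x 0 i) (fun x => x 0 i));
  exact: coord_continuous.
Qed.

End euclidean_norm.

(** * Lebesgue measure on row vectors *)

Section lebesgueN_theory.
Variables (R : realType) (n : nat).
Local Notation V := 'rV[R]_n.+1.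

(** The image of a box is again a box; its corners are exchanged when [c] is
    negative. *)
Lemma box_vol_affine (b : V) c (ab : V * V) : c != 0 ->
  exists2 cd : V * V, [set b + c *: x | x in box ab] `<=` box cd
    & box_vol cd = `|c| ^+ n.+1 * box_vol ab.
Proof.
move=> c0.
pose lo := if 0 < c then ab.1 else ab.2; pose hi := if 0 < c then ab.2 else ab.1.
exists (b + c *: lo, b + c *: hi) => [_ [x xab <-] i|].
  rewrite !mxE !lerD2l /lo /hi; have /andP[ax xb] := xab i.
  case: ifPn => [cp|]; first by rewrite !ler_pM2l// ax xb.
  by rewrite -leNgt le_eqVlt (negbTE c0)/= => cn; rewrite !ler_nM2l// ax xb.
rewrite -[in RHS](card_ord n.+1) -prodr_const /box_vol -big_split/=.
apply: eq_bigr => i _; rewrite !mxE maxr_pMr// mulr0; congr (Num.max 0 _).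
rewrite /lo /hi; case: ifPn => [cp|]; first by rewrite gtr0_norm//; ring.
by rewrite -leNgt => cn; rewrite ler0_norm//; ring.
Qed.

Lemma leb_outer_affine (b : V) (c : R) (A : set V) : c != 0 ->
  (leb_outer [set b + c *: x | x in A]%R <= (`|c| ^+ n.+1)%:E * leb_outer A)%E.
Proof.
move=> c0; have cn0 : 0 < `|c| ^+ n.+1 by rewrite exprn_gt0// normr_gt0.
rewrite muleC -lee_pdivrMr//; apply: le_ereal_inf_tmp => _ [F AF <-].
rewrite lee_pdivrMr//.
have /choice[G GP] : forall k, exists cd : V * V,
    [set b + c *: x | x in box (F k)] `<=` box cd /\
    box_vol cd = `|c| ^+ n.+1 * box_vol (F k).
  by move=> k; have [cd] := @box_vol_affine b c (F k) c0; exists cd.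
rewrite muleC -nneseriesZl => [|k _]; last by rewrite lee_fin box_vol_ge0.
apply: ereal_inf_lbound; exists G => [_ [x Ax <-]|].
  by have [k _ Fx] := AF _ Ax; exists k => //; apply: (GP k).1; exists x.
by apply: eq_eseriesr => k _; rewrite (GP k).2 EFinM.
Qed.

(** The measure does not see the reflection [y |-> x - y], which carries the
    kernel [J (x - y)] to [J]. *)
Lemma leb_outer_reflect (x : V) (A : set V) :
  leb_outer ((fun y => x - y) @^-1` A) = leb_outer A.
Proof.
have reflectE (B : set V) :
    (fun y => x - y) @^-1` B = [set x + (-1) *: y | y in B].
  apply/seteqP; split => [y By|_ [y By <-]] /=.
    by exists (x - y) => //; rewrite scaleN1r subKr.
  by rewrite scaleN1r subKr.
have reflect_le B : (leb_outer ((fun y => x - y)%R @^-1` B) <= leb_outer B)%E.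
  rewrite reflectE; apply: le_trans (leb_outer_affine x B _) _.
    by rewrite oppr_eq0 oner_eq0.
  by rewrite normrN normr1 expr1n mul1e.
apply/eqP; rewrite eq_le reflect_le/=.
rewrite (le_trans _ (reflect_le _))// le_eqVlt; apply/orP; left; apply/eqP.
by congr leb_outer; apply/seteqP; split => y /=; rewrite subKr.
Qed.

(** Makes the splitting property of a measurable set available without unfolding
    the structures on [lebRn]. *)
Lemma measurable_lebRnE (A : set (lebRn R n)) :
  measurable A = (@leb_outer R n).-caratheodory A.
Proof. by []. Qed.

Lemma measurable_reflect (x : V) :
  measurable_fun setT ((fun y : V => x - y) : lebRn R n -> lebRn R n).
Proof.
move=> _ B mB; rewrite setTI; move: mB; rewrite !measurable_lebRnE => mB X.
pose T (y : V) : V := x - y.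
have refl2 C : T @^-1` (T @^-1` X `&` C) = X `&` T @^-1` C.
  by apply/seteqP; split => y /=; rewrite /T subKr.
rewrite -/T -(leb_outer_reflect x X) (mB (T @^-1` X)).
rewrite -(leb_outer_reflect x (_ `&` B)) -(leb_outer_reflect x (_ `&` ~` B)).
by rewrite -/T !refl2.
Qed.

(** The side of a box cut at [a]; the truncations at [0] take care of the cuts
    that miss the box. *)
Lemma max0_split (l h a : R) :
  Num.max 0 (h - l) = Num.max 0 (Num.min h a - l) + Num.max 0 (h - Num.max l a).
Proof.
have [] := ltP 0 (h - l); have [] := ltP 0 (Num.min h a - l);
  have [] := ltP 0 (h - Num.max l a); have [] := ltP h a; have [] := ltP l a; lra.
Qed.

(** A closed box is cut by a coordinate hyperplane into two closed boxes whose
    volumes add up, so the hyperplane splits every cover without loss. *)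
Lemma measurable_halfspace i (a : R) :
  measurable ([set x : V | x 0 i <= a] : set (lebRn R n)).
Proof.
apply: le_caratheodory_measurable => X /=.
set H := [set x : V | x 0 i <= a].
apply: le_ereal_inf_tmp => _ [F XF <-].
pose lower (ab : V * V) : V * V :=
  (ab.1, \row_j if j == i then Num.min (ab.2 0 j) a else ab.2 0 j).
pose upper (ab : V * V) : V * V :=
  (\row_j (if j == i then Num.max (ab.1 0 j) a else ab.1 0 j), ab.2).
have vol_split ab : box_vol ab = box_vol (lower ab) + box_vol (upper ab).
  pose rest := \prod_(j | j != i) Num.max 0 (ab.2 0 j - ab.1 0 j).
  have volE (cd : V * V) :
      (forall j, j != i -> cd.2 0 j - cd.1 0 j = ab.2 0 j - ab.1 0 j) ->
      box_vol cd = Num.max 0 (cd.2 0 i - cd.1 0 i) * rest.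
    by move=> cdE; rewrite /box_vol (bigD1 i)//=; congr (_ * _);
      apply: eq_bigr => j ji; rewrite cdE.
  rewrite (volE ab)// (volE (lower ab)) => [|j /negbTE ji]; last by rewrite mxE ji.
  rewrite (volE (upper ab)) => [|j /negbTE ji]; last by rewrite mxE ji.
  by rewrite !mxE eqxx -mulrDl -max0_split.
rewrite (_ : (\sum_(k <oo) (box_vol (F k))%:E)%E =
  (\sum_(k <oo) (box_vol (lower (F k)))%:E +
   \sum_(k <oo) (box_vol (upper (F k)))%:E)%E); last first.
  rewrite -nneseriesD => [|k _|k _]; rewrite ?lee_fin ?box_vol_ge0//.
  by apply: eq_eseriesr => k _; rewrite vol_split EFinD.
apply: leeD; apply: ereal_inf_lbound.
  exists (lower \o F) => // x [Xx Hx]; have [k _ Fx] := XF _ Xx.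
  exists k => // j; have /andP[/= ax xb] := Fx j.
  by rewrite /= ax mxE; case: eqP xb => // -> xb; rewrite le_min xb.
exists (upper \o F) => // x [Xx /negP]; rewrite -ltNge => Hx.
have [k _ Fx] := XF _ Xx; exists k => // j; have /andP[/= ax xb] := Fx j.
by rewrite /= xb mxE andbT; case: eqP ax => // -> ax; rewrite ge_max ax ltW.
Qed.

(** An open set is the union of the half-open boxes with rational corners that
    it contains, and there are countably many of these. *)
Lemma open_measurable_lebRn (U : set V) :
  open U -> measurable (U : set (lebRn R n)).
Proof.
move=> oU.
pose Q (a b : 'rV[rat]_n.+1) : set V :=
  [set x | forall i, ratr (a 0 i) < x 0 i <= ratr (b 0 i)].
have mQ a b : measurable (Q a b : set (lebRn R n)).
  have -> : Q a b = ~` \bigcup_i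
      ~` ([set x | x 0 i <= ratr (b 0 i)] `\` [set x | x 0 i <= ratr (a 0 i)]).
    rewrite -setC_bigcap setCK; apply/seteqP; split => x Qx i => [_|].
      by have /andP[? ?] := Qx i; split => //=; apply/negP; rewrite -ltNge.
    have [//|/= -> /negP] := Qx i.
    by rewrite -ltNge => ->.
  apply: measurableC; apply: countable_bigcupT_measurable => // i.
  by apply: measurableC; apply: measurableD; exact: measurable_halfspace.
have -> : U = \bigcup_ab if `[<Q ab.1 ab.2 `<=` U>] then Q ab.1 ab.2 else set0.
  apply/seteqP; split => [x Ux|x [ab _]]; last by case: asboolP => // /[apply].
  have [e /= e0 xeU] := (nbhs_ballP _ _).1 (oU _ Ux).
  have /choice[f fP] i : exists r : rat * rat,
      x 0 i - e < ratr r.1 < x 0 i /\ x 0 i < ratr r.2 < x 0 i + e.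
    have [r1] : exists r, ratr r \in `]x 0 i - e, x 0 i[.
      by have [|r h] := @rat_in_itvoo R (x 0 i - e) (x 0 i); [lra|exists r].
    have [r2] : exists r, ratr r \in `]x 0 i, x 0 i + e[.
      by have [|r h] := @rat_in_itvoo R (x 0 i) (x 0 i + e); [lra|exists r].
    by rewrite !in_itv/= => h2 h1; exists (r1, r2).
  exists (\row_i (f i).1, \row_i (f i).2) => //=.
  case: asboolP => [_ i|].
    have [/andP[_ h1] /andP[/ltW h2 _]] := fP i.
    by rewrite /= !mxE h1 h2.
  case=> y Qy; apply: xeU; split => // i j; rewrite (ord1 i).
  have [/andP[h1 h2] /andP[h3 h4]] := fP j; have := Qy j; rewrite !mxE.
  by rewrite /ball/= => /andP[h5 h6]; rewrite ltr_norml; lra.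
apply: countable_bigcupT_measurable => // ab.
by case: asboolP.
Qed.

Lemma closed_measurable_lebRn (A : set V) :
  closed A -> measurable (A : set (lebRn R n)).
Proof.
move=> cA; rewrite -[A]setCK.
exact/measurableC/open_measurable_lebRn/closed_openC.
Qed.

Lemma within_continuous_measurable_lebRn (D : set V) (f : V -> R) :
  measurable (D : set (lebRn R n)) -> {within D, continuous f} ->
  measurable_fun (D : set (lebRn R n)) f.
Proof.
move=> mD /continuousP cf; apply: (measurability _ (RGenOpens.measurableE R)).
move=> _ [_ [a [b ->] <-]].
have /open_subspaceP[U oU UD] : open (f @^-1` `]a, b[ : set (subspace D)).
  exact/cf/interval_open.
rewrite setIC -UD; apply: measurableI => //; exact: open_measurable_lebRn.
Qed.

Lemma continuous_measurable_lebRn (f : V -> R) :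
  continuous f -> measurable_fun setT (f : lebRn R n -> R).
Proof.
move=> cf; apply: within_continuous_measurable_lebRn => //.
exact: continuous_subspaceT.
Qed.

Lemma measurable_enorm : measurable_fun setT (@enorm R n : lebRn R n -> R).
Proof. exact/continuous_measurable_lebRn/enorm_continuous. Qed.

Lemma measurable_exp_enorm (p : R) :
  measurable_fun setT ((fun z => expR (p * enorm z)) : lebRn R n -> R).
Proof.
apply: measurableT_comp; first exact: measurable_expR.
by apply: measurable_funM; [exact: measurable_cst|exact: measurable_enorm].
Qed.

Lemma closed_eball r : closed (@eball R n r).
Proof.
apply: (@preimage_closed V R (@enorm R n) [set z | z <= r]) => [x _|].
  exact: enorm_continuous.
exact: closed_le.
Qed.

Lemma measurable_eball r : measurable (@eball R n r : set (lebRn R n)).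
Proof. exact/closed_measurable_lebRn/closed_eball. Qed.

Lemma lebesgueN_eball_lty r : (lebesgueN (@eball R n r) < +oo)%E.
Proof.
pose b : V * V := (const_mx (- r), const_mx r).
have sub : eball r `<=` box b.
  by move=> x rx i; rewrite !mxE -ler_norml (le_trans (ler_coord_enorm _ _)).
apply: (@le_lt_trans _ _ (box_vol b)%:E); last exact: ltry.
(* One box suffices; the countable cover is completed by null boxes. *)
apply: ereal_inf_lbound; exists (fun k => if k == 0%N then b else (0, 0)).
  by move=> x /sub xb; exists 0%N.
rewrite (nneseries_split 0 1)//; last first.
  by move=> k _; rewrite lee_fin box_vol_ge0.
rewrite big_nat1 eseries0 ?adde0// => -[//|k] _ _ /=.
by rewrite box_vol00.
Qed.

Lemma measurable_sphere r :
  measurable ([set x | enorm x = r] : set (lebRn R n)).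
Proof.
apply: closed_measurable_lebRn.
apply: (@preimage_closed V R (@enorm R n) [set z | z = r]) => [x _|].
  exact: enorm_continuous.
exact: closed_eq.
Qed.

(** Dilating a ball by [1 / c] multiplies its measure by at most [c ^- n.+1],
    so the shell between the radii [c * r] and [r] has measure at most
    [(1 - c ^+ n.+1)] times that of the ball; let [c] tend to [1]. *)
Lemma lebesgueN_sphere r : 0 < r -> lebesgueN [set x : V | enorm x = r] = 0%E.
Proof.
move=> r0; set S := [set x | _].
have [b muB] : exists b, lebesgueN (@eball R n r) = b%:E.
  exists (fine (lebesgueN (@eball R n r))); rewrite fineK// ge0_fin_numE.
    exact: lebesgueN_eball_lty.
  exact: leb_outer_ge0.
have b0 : 0 <= b by rewrite -lee_fin -muB; exact: leb_outer_ge0.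
have shell c : 0 < c < 1 -> (lebesgueN S <= ((1 - c ^+ n.+1) * b)%:E)%E.
  move=> /andP[c0 c1].
  have sub : S `<=` eball r `\` eball (c * r).
    move=> x; rewrite /S/= => xr; split; rewrite /eball/= xr//.
    by apply/negP; rewrite -ltNge gtr_pMl.
  apply: (@le_trans _ _ (lebesgueN (@eball R n r `\` eball (c * r)))).
    exact: le_leb_outer.
  have -> : lebesgueN (@eball R n r `\` eball (c * r)) =
      (lebesgueN (@eball R n r) - lebesgueN (@eball R n r `&` eball (c * r)))%E.
    apply: measureD; [exact: measurable_eball|exact: measurable_eball|].
    exact: lebesgueN_eball_lty.
  rewrite muB setIidr; last first.
    by move=> x; rewrite /eball/= => /le_trans; apply; rewrite ler_piMl// ltW.
  have := @leb_outer_affine 0 c^-1 (eball (c * r)).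
  rewrite invr_eq0 gt_eqF// => /(_ isT).
  have -> : [set 0 + c^-1 *: x | x in @eball R n (c * r)] = eball r.
    apply/seteqP; split => [_ [x xr <-]|x xr]; rewrite /eball/= in xr *.
      by rewrite add0r enormZ gtr0_norm ?invr_gt0// mulrC ler_pdivrMr// mulrC.
    exists (c *: x); last by rewrite add0r scalerA mulVf ?scale1r ?gt_eqF.
    by rewrite enormZ gtr0_norm// ler_pM2l.
  rewrite -/(lebesgueN (eball r)) -/(lebesgueN (eball (c * r))) muB.
  have := lebesgueN_eball_lty (c * r).
  have := leb_outer_ge0 (@eball R n (c * r)).
  rewrite -/(lebesgueN (eball (c * r))).
  case: (lebesgueN _) => // d d0 _; rewrite gtr0_norm ?invr_gt0// exprVn.
  rewrite -!(EFinM, EFinB) !lee_fin => h.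
  suff : c ^+ n.+1 * b <= d by lra.
  by rewrite mulrC -ler_pdivlMr ?exprn_gt0// mulrC.
have [s muS] : exists s, lebesgueN S = s%:E.
  exists (fine (lebesgueN S)); rewrite fineK// ge0_fin_numE ?leb_outer_ge0//.
  apply: (le_lt_trans (shell 2^-1 _)); last exact: ltry.
  by rewrite invr_gt0 invf_lt1//; lra.
have s0 : 0 <= s by rewrite -lee_fin -muS leb_outer_ge0.
apply/eqP; rewrite muS eqe eq_le s0 andbT.
have lim : (1 - c ^+ n.+1) * b @[c --> 1^'-] --> (0 : R).
  rewrite [X in _ --> X](_ : _ = (1 - 1 ^+ n.+1) * b); last first.
    by rewrite expr1n subrr mul0r.
  apply: cvg_at_left_filter.
  apply: cvgMl => //; apply: cvgB; first exact: cvg_cst.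
  exact: exprn_continuous.
rewrite -(cvg_lim (@Rhausdorff R) lim); apply: limr_ge.
  by apply/cvg_ex; exists 0.
near=> c; rewrite -lee_fin -muS; apply: shell; apply/andP; split; last first.
  by near: c; exact: nbhs_left_lt.
by near: c; exact: nbhs_left_gt.
Unshelve. all: by end_near. Qed.

Lemma ge0_integral_reflect (x : V) (f : V -> \bar R) :
  measurable_fun setT (f : lebRn R n -> \bar R) -> (forall y, 0 <= f y)%E ->
  (\int[lebesgueN]_y f (x - y)%R = \int[lebesgueN]_y f y)%E.
Proof.
move=> mf f0.
have := ge0_integral_pushforward (measurable_reflect x) lebesgueN measurableT mf
  (fun y _ => f0 y).
rewrite preimage_setT => <-.
have -> : pushforward (@lebesgueN R n) (fun y : V => x - y : lebRn R n) =
    @lebesgueN R n by apply/funext => A; exact: (leb_outer_reflect x A).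
by [].
Qed.

End lebesgueN_theory.

(** * Convolution with an exponential weight *)

Section kernel.
Variables (R : realType) (n : nat).
Local Notation V := 'rV[R]_n.+1.
Variable J : V -> R.
Hypothesis J_ge0 : forall y, 0 <= J y.
Hypothesis J_meas : measurable_fun setT (J : lebRn R n -> R).
Hypothesis J_int1 : (\int[lebesgueN]_y (J y)%:E = 1)%E.

Let J_integrable : lebesgueN.-integrable setT (EFin \o J : lebRn R n -> _).
Proof.
apply/integrableP; split; first exact/measurable_EFinP.
under eq_integral do rewrite /= ger0_norm//.
by rewrite J_int1 ltry.
Qed.

(** By the triangle inequality [expR (p * enorm y)] is at most
    [expR (p * enorm x) * expR (p * enorm (x - y))], so this weight is multiplied
    by at most the exponential moment of [J] under convolution. *)
Lemma convolution_exp_bound (p K a b : R) (g : V -> R) (x : V) :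
  0 <= p -> 0 <= a -> 0 <= b ->
  (\int[lebesgueN]_z (J z * expR (p * enorm z))%:E <= K%:E)%E ->
  measurable_fun setT (g : lebRn R n -> R) ->
  (forall y, `|g y| <= a * expR (p * enorm y) + b) ->
  lebesgueN.-integrable setT
    ((fun y => (J (x - y) * g y)%:E) : lebRn R n -> \bar R) /\
  `|\int[lebesgueN]_y (J (x - y) * g y)| <= a * K * expR (p * enorm x) + b.
Proof.
move=> p0 a0 b0 JK mg g_le.
pose f y := J (x - y) * g y.
pose h z := a * expR (p * enorm x) * (J z * expR (p * enorm z)) + b * J z.
have mf : measurable_fun setT (f : lebRn R n -> R).
  apply: measurable_funM; last exact: mg.
  exact: (measurableT_comp J_meas (measurable_reflect x)).
have mJe : measurable_fun setT
    ((fun z => J z * expR (p * enorm z)) : lebRn R n -> R).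
  by apply: measurable_funM; [exact: J_meas|exact: measurable_exp_enorm].
have h0 z : 0 <= h z.
  by rewrite addr_ge0 ?mulr_ge0 ?expR_ge0.
have mh : measurable_fun setT (h : lebRn R n -> R).
  apply: measurable_funD.
    by apply: measurable_funM; [exact: measurable_cst|exact: mJe].
  by apply: measurable_funM; [exact: measurable_cst|exact: J_meas].
have fh y : `|f y| <= h (x - y).
  rewrite normrM (ger0_norm (J_ge0 _)) (le_trans (ler_wpM2l _ (g_le y)))//.
  rewrite /h mulrDr (mulrC (J _) b) lerD2r.
  rewrite [leLHS]mulrCA -!mulrA ler_wpM2l//.
  rewrite [leRHS]mulrCA ler_wpM2l// -expRD ler_expR -mulrDr ler_wpM2l//.
  rewrite (_ : enorm y = enorm (x + (-1) *: (x - y))).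
    by rewrite (le_trans (ler_enormD _ _))// enormZ normrN1 mul1r.
  by rewrite scaleN1r subKr.
have int_h : (\int[lebesgueN]_y (h (x - y))%:E
    <= (a * K * expR (p * enorm x) + b)%:E)%E.
  rewrite (ge0_integral_reflect x (f := EFin \o h)); last 2 first.
  - exact/measurable_EFinP.
  - by move=> z; rewrite lee_fin.
  rewrite (eq_integral (fun z : lebRn R n => (a * expR (p * enorm x))%:E *
    (J z * expR (p * enorm z))%:E + b%:E * (J z)%:E)%E) => [|z _]; last first.
    by rewrite -!EFinM -EFinD.
  have mJeE : measurable_fun setT
      ((fun z => (J z * expR (p * enorm z))%:E) : lebRn R n -> \bar R).
    exact/measurable_EFinP.
  have mJE : measurable_fun setT ((fun z => (J z)%:E) : lebRn R n -> \bar R).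
    exact/measurable_EFinP.
  have Je0 (z : lebRn R n) : setT z -> (0 <= (J z * expR (p * enorm z))%:E)%E.
    by rewrite lee_fin mulr_ge0// expR_ge0.
  have J0 (z : lebRn R n) : setT z -> (0 <= (J z)%:E)%E by rewrite lee_fin.
  have c0 : (0 <= (a * expR (p * enorm x))%:E)%E.
    by rewrite lee_fin mulr_ge0// expR_ge0.
  have b0E : (0 <= b%:E)%E by rewrite lee_fin.
  rewrite (ge0_integralD _ measurableT (fun z Tz => mule_ge0 c0 (Je0 z Tz))
    (measurable_funeM _ mJeE) (fun z Tz => mule_ge0 b0E (J0 z Tz))
    (measurable_funeM _ mJE)).
  rewrite (ge0_integralZl _ measurableT mJeE Je0 c0).
  rewrite (ge0_integralZl _ measurableT mJE J0 b0E).
  by rewrite J_int1 mule1 EFinD leeD2r// mulrAC (EFinM _ K) lee_wpmul2l.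
have abs_f : (\int[lebesgueN]_y `|(f y)%:E|
    <= (a * K * expR (p * enorm x) + b)%:E)%E.
  apply: le_trans int_h; apply: ge0_le_integral.
  - exact: measurableT.
  - by move=> y _; exact: abse_ge0.
  - by apply: measurableT_comp; [exact: abse_measurable|exact/measurable_EFinP].
  - apply/measurable_EFinP.
    exact: (measurableT_comp mh (measurable_reflect x)).
  - by move=> y _; rewrite lee_fin.
have int_f : lebesgueN.-integrable setT (EFin \o f : lebRn R n -> \bar R).
  apply/integrableP; split; first exact/measurable_EFinP.
  exact: le_lt_trans abs_f (ltry _).
split=> //.
rewrite -lee_fin EFin_normr_Rintegral; [|exact: measurableT|exact: int_f].
apply: le_trans abs_f; apply: le_abse_integral; first exact: measurableT.
exact/measurable_EFinP.
Qed.

(** Since spheres are null, [expR (p * (enorm z - eta))] decreases to [0] as [p]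
    grows, at almost every [z] where [J] is nonzero; dominated convergence along
    [p = k%:R] gives one good exponent, and monotonicity in [p] all later ones. *)
Lemma exp_moment_small (eta : R) : 0 < eta ->
  (forall z, eta < enorm z -> J z = 0) ->
  forall e, 0 < e -> exists2 p0 : R, 0 <= p0 & forall p, p0 <= p ->
    (\int[lebesgueN]_z (J z * expR (p * enorm z))%:E
     <= (e * expR (p * eta))%:E)%E.
Proof.
move=> eta0 J_out e e0.
pose f (p : R) z := J z * expR (p * (enorm z - eta)).
have mf p : measurable_fun setT (f p : lebRn R n -> R).
  apply: measurable_funM; first exact: J_meas.
  apply: measurableT_comp; first exact: measurable_expR.
  apply: measurable_funM; first exact: measurable_cst.
  by apply: measurable_funB; [exact: measurable_enorm|exact: measurable_cst].
have f0 p z : 0 <= f p z by rewrite mulr_ge0 ?expR_ge0.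
have f_le p q z : p <= q -> f q z <= f p z.
  move=> pq; have [zeta|/J_out Jz0] := leP (enorm z) eta.
    by rewrite ler_wpM2l// ler_expR ler_wnM2r// subr_le0.
  by rewrite /f Jz0 !mul0r.
have f_0 z : f 0 z = J z by rewrite /f mul0r expR0 mulr1.
have lim_ae : {ae lebesgueN, forall z : lebRn R n, setT z ->
    (f k%:R z)%:E @[k --> \oo] --> (cst 0%E : lebRn R n -> \bar R) z}.
  exists [set z | enorm z = eta]; split.
  - exact: measurable_sphere.
  - exact: lebesgueN_sphere.
  - move=> z /=; apply: contra_notP => /eqP zeta _.
    have [/J_out Jz0|zle] := ltP eta (enorm z).
      by under eq_fun do rewrite /f Jz0 mul0r; exact: cvg_cst.
    apply: cvg_EFin; first exact: nearW.
    rewrite -[X in _ --> X](mulr0 (J z)).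
    apply: cvgMr => //; under eq_fun do rewrite expRM_natl.
    apply: cvg_expr.
    by rewrite ger0_norm ?expR_ge0// expR_lt1 subr_lt0 lt_neqAle zeta.
have dom_ae : {ae lebesgueN, forall z : lebRn R n, forall k, setT z ->
    (`|(f k%:R z)%:E| <= (EFin \o J) z)%E}.
  by apply: aeW => z k _; rewrite /= ger0_norm// -(f_0 z) lee_fin f_le.
have mfE (k : nat) : measurable_fun setT
    ((fun z => (f k%:R z)%:E) : lebRn R n -> \bar R).
  exact/measurable_EFinP.
have [_ _] := @dominated_convergence _ (lebRn R n) R lebesgueN setT measurableT
  _ _ _ mfE (measurable_cst _) lim_ae J_integrable dom_ae.
rewrite integral0 => lim.
have /= [k _ /(_ k (leqnn k)) fk] : \forall k \near \oo,
    (\int[lebesgueN]_z (f k%:R z)%:E < e%:E)%E.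
  apply: (lim [set y | (y < e%:E)%E]); apply: open_nbhs_nbhs; split.
    exact: open_ereal_lt_ereal.
  by rewrite /= lte_fin.
exists k%:R => // p kp.
have mfpE : measurable_fun setT
    ((fun z => (f p z)%:E) : lebRn R n -> \bar R).
  exact/measurable_EFinP.
have fp0 (z : lebRn R n) : setT z -> (0 <= (f p z)%:E)%E by rewrite lee_fin.
rewrite (eq_integral (fun z : lebRn R n =>
  (expR (p * eta))%:E * (f p z)%:E)%E) => [|z _]; last first.
  by rewrite -EFinM /f mulrCA -expRD -mulrDr addrC subrK.
rewrite (ge0_integralZl _ measurableT mfpE fp0) ?lee_fin ?expR_ge0//.
rewrite (mulrC e) (EFinM _ e) lee_wpmul2l ?lee_fin ?expR_ge0//.
apply: le_trans (ltW fk); apply: ge0_le_integral.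
- exact: measurableT.
- exact: fp0.
- exact: mfpE.
- exact: mfE.
- by move=> z _; rewrite lee_fin f_le.
Qed.

End kernel.

(** * Comparison in time *)

Lemma within_continuous_comp (X Y Z : topologicalType) (A : set X) (D : set Y)
    (f : X -> Y) (g : Y -> Z) :
  continuous f -> (forall x, A x -> D (f x)) -> {within D, continuous g} ->
  {within A, continuous (g \o f)}.
Proof.
move=> cf fA /subspace_continuousP cg; apply/subspace_continuousP => x Ax W nW.
have gW := cg _ (fA _ Ax) _ nW.
have := cf x _ gW; rewrite /= !nbhs_simpl /= /within/=.
by apply: filterS => y /= h Ay; apply: h; exact: fA.
Qed.

Lemma continuous_pairr (X Y : topologicalType) (x : X) :
  continuous (fun y : Y => (x, y)).
Proof. by move=> y; apply: cvg_pair => //; exact: cvg_cst. Qed.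

Lemma continuous_pairl (X Y : topologicalType) (y : Y) :
  continuous (fun x : X => (x, y)).
Proof. by move=> x; apply: cvg_pair => //; exact: cvg_cst. Qed.

(** With the integrating factor [expR], the derivative of
    [expR s * (h s + phi s)] is [expR s * (h s + dh s + g s)], which is
    nonnegative since [- g <= dh] and [0 <= h]; the same applies to [- phi]. *)
Lemma damped_comparison (R : realType) (phi g h dh : R -> R) (T : R) :
  0 <= T ->
  {within `[0, T], continuous phi} -> {within `[0, T], continuous h} ->
  (forall s : R, 0 < s -> is_derive s 1 phi (g s - phi s)) ->
  (forall s : R, 0 < s -> is_derive s 1 h (dh s)) ->
  (forall s : R, 0 <= s -> 0 <= h s) -> (forall s : R, 0 < s -> `|g s| <= dh s) ->
  phi 0 = 0 -> `|phi T| <= h T.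
Proof.
move=> T0.
have one_sided (psi f : R -> R) :
    {within `[0, T], continuous psi} -> {within `[0, T], continuous h} ->
    (forall s : R, 0 < s -> is_derive s 1 psi (f s - psi s)) ->
    (forall s : R, 0 < s -> is_derive s 1 h (dh s)) ->
    (forall s : R, 0 <= s -> 0 <= h s) -> (forall s : R, 0 < s -> `|f s| <= dh s) ->
    psi 0 = 0 -> - psi T <= h T.
  move=> cpsi ch dpsi dhh h0 fle psi0.
  pose F (s : R) := expR s * (h s + psi s).
  have dF (s : R) : 0 < s -> is_derive s 1 F (expR s * (h s + dh s + f s)).
    move=> s0; have ? := dpsi s s0; have ? := dhh s s0.
    apply: is_derive_eq; rewrite /GRing.scale/=; ring.
  have : F 0 <= F T.
    apply: (@ger0_derive1_ndecr R F 0 T) => //.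
    - by move=> s /[!in_itv]/= /andP[s0 _]; have [] := dF _ s0.
    - move=> s /[!in_itv]/= /andP[s0 _]; rewrite derive1E.
      have [_ ->] := dF _ s0; rewrite mulr_ge0 ?expR_ge0//.
      have := fle _ s0; rewrite ler_norml => /andP[fs _].
      by have := h0 s (ltW s0); lra.
    - move=> s; apply: continuousM.
        by apply: continuous_subspaceT; exact: continuous_expR.
      by apply: continuousD; [exact: ch|exact: cpsi].
  rewrite /F expR0 mul1r psi0 addr0 => FT.
  have : 0 <= expR T * (h T + psi T) by exact: le_trans (h0 _ _) FT.
  by rewrite pmulr_rge0 ?expR_gt0// => ?; lra.
move=> cphi ch dphi dhh h0 gle phi0; rewrite ler_norml; apply/andP; split.
  by rewrite lerNl; exact: (one_sided phi g).
rewrite -[phi T]opprK; apply: (one_sided (fun s => - phi s) (fun s => - g s)) => //.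
- by move=> s; apply: continuousN; exact: cphi.
- move=> s s0; have ? := dphi s s0; apply: is_derive_eq; ring.
- by move=> s s0; rewrite normrN gle.
- by rewrite phi0 oppr0.
Qed.

(** The majorant at stage [k.+1] of the iteration in [truncation_error] has for
    derivative [K] times its exponential part plus the remainder of stage [k]. *)
Lemma is_derive_majorant (R : realType) (a K B : R) (k : nat) (z : R) :
  is_derive z 1 (fun s : R => a * expR (K * s) + B * (s ^+ k.+1 / k.+1`!%:R))
    (a * expR (K * z) * K + B * (z ^+ k / k`!%:R)).
Proof.
have dpow : is_derive z 1 (fun s : R => s ^+ k.+1) (k.+1%:R * z ^+ k).
  apply: DeriveDef; first exact: exprn_derivable.
  by rewrite exp_derive /GRing.scale/= mulr1.
have -> : z ^+ k / k`!%:R = (k.+1%:R * z ^+ k) / k.+1`!%:R.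
  by rewrite factS natrM invfM mulrACA divff ?mul1r.
move: (k.+1`!%:R^-1) => c.
have dexp : is_derive z 1 (fun s : R => expR (K * s)) (expR (K * z) * K).
  apply: is_derive1_comp; apply: is_derive_eq.
  by rewrite /GRing.scale/= mulr1.
apply: is_derive_eq; rewrite /GRing.scale/=; ring.
Qed.

(** * Effect of truncating the domain *)

Section truncation_error.
Variables (R : realType) (n : nat).
Local Notation V := 'rV[R]_n.+1.
Variable J : V -> R.
Hypothesis J_ge0 : forall y, 0 <= J y.
Hypothesis J_meas : measurable_fun setT (J : lebRn R n -> R).
Hypothesis J_int1 : (\int[lebesgueN]_y (J y)%:E = 1)%E.
Variables (u0 : V -> R) (u v : V -> R -> R) (r M p K : R).
Hypothesis u_sol : strong_solution J u0 u.
Hypothesis v_sol : dirichlet_solution J u0 r v.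
Hypothesis u_le : forall x (t : R), 0 <= t -> `|u x t| <= M.
Hypothesis p_ge0 : 0 <= p.
Hypothesis K_moment :
  (\int[lebesgueN]_z (J z * expR (p * enorm z))%:E <= K%:E)%E.

Let w x t := u x t - v x t.

Let M_ge0 : 0 <= M.
Proof. exact: le_trans (normr_ge0 _) (u_le 0 (lexx 0)). Qed.

Let K_ge0 : 0 <= K.
Proof.
rewrite -lee_fin; apply: le_trans K_moment; apply: integral_ge0 => z _.
by rewrite lee_fin mulr_ge0 ?expR_ge0.
Qed.

Let measurable_u (t : R) : 0 <= t ->
  measurable_fun setT ((fun y => u y t) : lebRn R n -> R).
Proof.
move=> t0; have [cu _ _ _] := u_sol; apply: within_continuous_measurable_lebRn => //.
by apply: (within_continuous_comp (@continuous_pairl V R t) _ cu).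
Qed.

Let measurable_v (t : R) : 0 <= t ->
  measurable_fun setT ((fun y => v y t) : lebRn R n -> R).
Proof.
move=> t0; have [_ cv _ _ v_out] := v_sol.
rewrite (_ : (fun y => v y t) =
    (fun y : lebRn R n => v y t) \_ (eball r : set (lebRn R n))); last first.
  apply/funext => y; rewrite patchE; case: ifPn => // /negP.
  by rewrite inE => /v_out ->.
apply: (measurable_restrictT _ (@measurable_eball R n r)).1.
apply: within_continuous_measurable_lebRn; first exact: measurable_eball.
by apply: (within_continuous_comp (@continuous_pairl V R t) _ cv).
Qed.

Let derive_w x (t : R) : eball r x -> 0 < t ->
  is_derive t 1 (w x) (\int[lebesgueN]_y (J (x - y) * w y t) - w x t).
Proof.
move=> xr t0; have [_ _ du _] := u_sol; have [[Mv v_le] _ dv _ v_out] := v_sol.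
have int_bnd (f : V -> R) (B : R) : measurable_fun setT (f : lebRn R n -> R) ->
    (forall y, `|f y| <= B) -> lebesgueN.-integrable setT
    (EFin \o (fun y => J (x - y) * f y) : lebRn R n -> \bar R).
  move=> mf fB; have B0 : 0 <= B := le_trans (normr_ge0 _) (fB 0).
  have [] // := convolution_exp_bound J_ge0 J_meas J_int1 x p_ge0 (lexx 0) B0
    K_moment mf.
  by move=> y; rewrite mul0r add0r.
have iu := int_bnd _ M (measurable_u (ltW t0)) (fun y => u_le y (ltW t0)).
have iv := int_bnd _ Mv (measurable_v (ltW t0)) (fun y => v_le y t (ltW t0)).
have dut := du x t t0; have dvt := dv x t xr t0.
apply: is_derive_eq.
have -> : \int[lebesgueN]_(y in @eball R n r) (J (x - y) * v y t) =
    \int[lebesgueN]_y (J (x - y) * v y t).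
  rewrite Rintegral_mkcond; apply: eq_Rintegral => y _; rewrite patchE.
  by case: ifPn => // /negP; rewrite inE => /v_out ->; rewrite ?mulr0// ltW.
have -> : \int[lebesgueN]_y (J (x - y) * w y t) =
    \int[lebesgueN]_y (J (x - y) * u y t - J (x - y) * v y t).
  by apply: eq_Rintegral => y _; rewrite /w mulrBr.
rewrite (RintegralB measurableT iu iv) /w; ring.
Qed.

(** Comparison with the supersolution
    [M * expR (p * (enorm x - r)) * expR (K * t)], which dominates [u] outside
    the ball. That [w] exceeds it by at most [B * t ^+ k / k`!] is clear for
    [k = 0]; each integration in time raises [k], so the excess vanishes in the
    limit. This is why an a priori bound on [v] that depends on [r] is enough. *)
Lemma truncation_error (x : V) (t : R) : eball r x -> 0 <= t ->
  `|u x t - v x t| <= M * expR (p * (enorm x - r)) * expR (K * t).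
Proof.
move=> xr t0; have [cu _ _ u_0] := u_sol.
have [[Mv v_le] cv _ v_0 v_out] := v_sol.
pose B := M + Mv.
have B0 : 0 <= B by rewrite addr_ge0// (le_trans (normr_ge0 _) (v_le 0 0 _)).
pose S (y : V) (s : R) := M * expR (p * (enorm y - r)) * expR (K * s).
have S0 y s : 0 <= S y s by rewrite !mulr_ge0 ?expR_ge0.
have step k : forall (y : V) (s : R), 0 <= s -> `|w y s| <= S y s + B * (s ^+ k / k`!%:R).
  elim: k => [|k IH] y s s0.
    rewrite expr0 fact0 divr1 mulr1 (le_trans (ler_normB _ _))//.
    by rewrite (le_trans (lerD (u_le _ s0) (v_le _ _ s0)))// lerDr.
  have [yr|yr] := pselect (eball r y); last first.
    have rem0 : 0 <= B * (s ^+ k.+1 / k.+1`!%:R).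
      by rewrite mulr_ge0// divr_ge0// exprn_ge0.
    rewrite /w (v_out _ _ yr s0) subr0 (le_trans (u_le _ s0))//.
    rewrite (le_trans _ (_ : S y s <= _)) ?lerDl// /S -mulrA ler_peMr//.
    rewrite -expRD -expR0 ler_expR addr_ge0 ?mulr_ge0// subr_ge0.
    by move/negP: yr; rewrite -ltNge => /ltW.
  pose h (s : R) := S y s + B * (s ^+ k.+1 / k.+1`!%:R).
  pose dh (s : R) := S y s * K + B * (s ^+ k / k`!%:R).
  have dhP (z : R) : is_derive z 1 h (dh z).
    exact: is_derive_majorant.
  apply: (@damped_comparison R (w y)
    (fun z => \int[lebesgueN]_y' (J (y - y') * w y' z)) h dh) => //.
  - move=> z; apply: continuousB.
      apply: (within_continuous_comp (@continuous_pairr V R y) _ cu) z.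
      by move=> z /=; rewrite in_itv/= => /andP[].
    apply: (within_continuous_comp (@continuous_pairr V R y) _ cv) z.
    by move=> z /=; rewrite in_itv/= => /andP[].
  - apply: continuous_subspaceT => z.
    by apply: differentiable_continuous; apply/derivable1_diffP; have [] := dhP z.
  - by move=> z z0; exact: derive_w.
  - by move=> z z0; rewrite addr_ge0// mulr_ge0// divr_ge0// exprn_ge0.
  - move=> z z0.
    have zk : 0 <= B * (z ^+ k / k`!%:R).
      by rewrite mulr_ge0// divr_ge0// exprn_ge0// ltW.
    pose a := M * expR (- (p * r)) * expR (K * z).
    have a0 : 0 <= a by rewrite !mulr_ge0 ?expR_ge0.
    have SE y' : S y' z = a * expR (p * enorm y').
      by rewrite /S /a mulrBr expRD; ring.
    have mw : measurable_fun setT ((fun y' => w y' z) : lebRn R n -> R).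
      apply: measurable_funB; first exact: measurable_u (ltW z0).
      exact: measurable_v (ltW z0).
    have [|_] := convolution_exp_bound J_ge0 J_meas J_int1 y p_ge0 a0 zk K_moment
      mw.
      by move=> y'; rewrite -SE; exact: IH (ltW z0).
    by rewrite /dh SE (mulrAC a).
  - by rewrite /w u_0 v_0 ?subrr.
have lim : S x t + B * (t ^+ k / k`!%:R) @[k --> \oo] --> S x t.
  rewrite -[X in _ --> X]addr0 -[X in _ --> _ + X](mulr0 B).
  apply: cvgD; first exact: cvg_cst.
  by apply: cvgMr; exact: cvg_exp_coeff.
rewrite -[leRHS](cvg_lim (@Rhausdorff R) lim); apply: limr_ge.
  by apply/cvg_ex; exists (S x t).
by apply: nearW => k; exact: step.
Qed.

End truncation_error.

(** * The logarithmic rate *)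

Theorem corollary4p2 (R : realType) (n : nat) (eta : R) (heta : 0 < eta)
  (J : 'rV[R]_n.+1 -> R)
  (J_ge0 : forall y, 0 <= J y)
  (J_meas : measurable_fun setT (J : lebRn R n -> R))
  (J_radial : forall x y, enorm x = enorm y -> J x = J y)
  (J_int1 : (\int[lebesgueN]_y (J y)%:E = 1)%E)
  (J_exp : forall p : 'rV[R]_n.+1,
    (\int[lebesgueN]_y ((expR (dot p y) - 1) * J y)%:E < +oo)%E)
  (J_supp : closure [set y | J y != 0] = eball eta)
  (u0 : 'rV[R]_n.+1 -> R)
  (u0_ge0 : forall x, 0 <= u0 x)
  (u0_cont : continuous u0)
  (u0_bounded : exists M : R, forall x, u0 x <= M)
  (u : 'rV[R]_n.+1 -> R -> R)
  (u_bounded : bounded_solution u)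
  (u_sol : strong_solution J u0 u)
  (uR : R -> 'rV[R]_n.+1 -> R -> R)
  (uR_sol : forall r : R, 0 < r -> dirichlet_solution J u0 r (uR r)) :
  forall theta : R, 0 < theta < 1 -> forall t : R, 0 < t ->
  exists2 o : R -> R, o r @[r --> +oo] --> 0 &
    \forall r \near +oo,
      (ereal_sup [set `|u x t - uR r x t|%:E | x in eball (theta * r)]
       <= (expR (- ((1 - theta) * r / eta) * ln ((1 - theta) * r / t)
                 + o r * r))%:E)%E.
Proof.
move=> theta /andP[theta0 theta1] t t0.
exists (fun=> 0); first exact: cvg_cst.
have [M u_le] := u_bounded.
have J_out z : eta < enorm z -> J z = 0.
  move=> zeta; apply/eqP; apply: contraTT zeta => Jz0.
  rewrite -leNgt; suff : eball eta z by [].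
  by rewrite -J_supp; exact: subset_closure.
(* With this [e], half of the gain [- a / eta] below is kept for [M]. *)
pose e := (2 * eta * expR 1)^-1.
have e0 : 0 < e by rewrite invr_gt0 !mulr_gt0 ?expR_gt0.
have [p0 p00 moment] := exp_moment_small J_ge0 J_meas J_int1 heta J_out e0.
have theta1' : 0 < 1 - theta by rewrite subr_gt0.
near=> r.
have r0 : 0 < r by near: r; exact: nbhs_pinfty_gt.
have Ma : 2 * eta * M <= (1 - theta) * r.
  rewrite (mulrC (1 - _)) -(ler_pdivrMr _ _ theta1').
  by near: r; apply: nbhs_pinfty_ge; exact: num_real.
have pa : t * expR (eta * p0) <= (1 - theta) * r.
  rewrite (mulrC (1 - _)) -(ler_pdivrMr _ _ theta1').
  by near: r; apply: nbhs_pinfty_ge; exact: num_real.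
pose a := (1 - theta) * r; rewrite -/a in Ma pa *.
have a0 : 0 < a by rewrite mulr_gt0.
(* The optimal exponent for [K = expR (p * eta)] up to an additive constant,
   chosen so that [- p * a] contains the gain [- a / eta]. *)
pose p := (1 + ln (a / t)) / eta.
have at0 : 0 < a / t by rewrite divr_gt0.
have p0p : p0 <= p.
  rewrite /p ler_pdivlMr// -[leLHS]expRK.
  rewrite -[leLHS]add0r lerD// ler_ln ?posrE ?expR_gt0//.
  by rewrite ler_pdivlMr// mulrC (mulrC p0).
have p_ge0 : 0 <= p := le_trans p00 p0p.
have expE : expR (p * eta) = expR 1 * (a / t).
  by rewrite /p divfK ?gt_eqF// expRD lnK// posrE.
apply: ge_ereal_sup => _ [x xr <-]; rewrite lee_fin.
have xr' : eball r x.
  by apply: le_trans xr _; rewrite ler_piMl// ltW.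
have err := truncation_error J_ge0 J_meas J_int1 u_sol (uR_sol r r0) u_le
  p_ge0 (moment p p0p) xr' (ltW t0).
apply: le_trans err _.
rewrite mul0r addr0 expE.
have eE : e * (expR 1 * (a / t)) * t = a / (2 * eta).
  by rewrite /e; field; rewrite !gt_eqF ?expR_gt0.
rewrite eE.
have ME : M <= expR (a / (2 * eta)).
  apply: le_trans (expR_ge1Dx _); rewrite -[leLHS]add0r lerD//.
  by rewrite ler_pdivlMr ?mulr_gt0// mulrC.
apply: (@le_trans _ _ (expR (a / (2 * eta)) * expR (p * (theta * r - r)) *
  expR (a / (2 * eta)))).
  rewrite ler_wpM2r ?expR_ge0// ler_pM ?expR_ge0//.
    exact: le_trans (normr_ge0 _) (u_le 0 0 (lexx 0)).
  by rewrite ler_expR ler_wpM2l// lerD2r.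
rewrite -!expRD ler_expR -/a le_eqVlt; apply/orP; left; apply/eqP.
by rewrite /p /a; field; rewrite !gt_eqF.
Unshelve. all: by end_near. Qed.
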